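(* Let $(X,G)$ be a $G$-action topological dynamical system with $G$ a countable infinite discrete amenable group. Let $\varepsilon>0$, let $Z$ be a subset of $X$, and let $\{F_n\}$ be a sequence of finite subsets of $G$ satisfying the growth condition $\lim_{n\to+\infty}\frac{|F_n|}{\log n}=+\infty$. (1) $$h^P_{top}(Z,\varepsilon,\{F_n\})\le\inf\Big\{\sup_{i\ge1}h^{UC}_{top}(Z_i,\varepsilon,\{F_n\}):Z=\bigcup_{i=1}^\infty Z_i\Big\}.$$ Hence $$h^P_{top}(Z,\{F_n\})\le\inf\Big\{\sup_{i\ge1}h^{UC}_{top}(Z_i,\{F_n\}):Z=\bigcup_{i=1}^\infty Z_i\Big\}.$$ (2) For any $\delta>0$ there exists a cover $\bigcup_{i=1}^\infty Z_i=Z$ (depending on both $\varepsilon$ and $\delta$) such that $$h^P_{top}(Z,\varepsilon,\{F_n\})+\delta\ge\sup_{i\ge1}h^{UC}_{top}(Z_i,3\varepsilon,\{F_n\}).$$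
   Context: $(X,G)$ being a $G$-action topological dynamical system means that $X$ is a compact metric space with metric $d$ and the discrete group $G$ acts continuously on $X$. For finite $F\subset G$ put $d_F(x,y)=\max_{g\in F}d(gx,gy)$ and $\overline B_F(x,\varepsilon)=\{y\in X:d_F(x,y)\le\varepsilon\}$. Packing entropy. For $Z\subseteq X$, $s\ge 0$, $N\in\mathbb N$, $\varepsilon>0$, let $P(Z,N,\varepsilon,s,\{F_n\})=\sup\sum_i\exp(-s|F_{n_i}|)$, the supremum over all finite or countable pairwise disjoint families $\{\overline B_{F_{n_i}}(x_i,\varepsilon)\}$ with $x_i\in Z$ and $n_i\ge N$ for all $i$. Let $P(Z,\varepsilon,s,\{F_n\})=\lim_{N\to+\infty}P(Z,N,\varepsilon,s,\{F_n\})$ and $$\mathcal P(Z,\varepsilon,s,\{F_n\})=\inf\Big\{\sum_{i=1}^{+\infty}P(Z_i,\varepsilon,s,\{F_n\}):\bigcup_{i=1}^{+\infty}Z_i\supseteq Z\Big\}.$$ $h^P_{top}(Z,\varepsilon,\{F_n\})\in[0,+\infty]$ is the critical value of $s$ at which $\mathcal P(Z,\varepsilon,s,\{F_n\})$ jumps from $+\infty$ to $0$, and $h^P_{top}(Z,\{F_n\})=\lim_{\varepsilon\to0}h^P_{top}(Z,\varepsilon,\{F_n\})$. Upper capacity entropy. A subset $E\subseteq Z$ is an $(F,\varepsilon)$-separated set of $Z$ if $d_F(x,y)>\varepsilon$ for any two distinct $x,y\in E$; $s_F(Z,\varepsilon)$ is the largest cardinality of an $(F,\varepsilon)$-separated set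 of $Z$. Then $h^{UC}_{top}(Z,\varepsilon,\{F_n\})=\limsup_{n\to+\infty}\frac1{|F_n|}\log s_{F_n}(Z,\varepsilon)$ and $h^{UC}_{top}(Z,\{F_n\})=\lim_{\varepsilon\to0}h^{UC}_{top}(Z,\varepsilon,\{F_n\})$. *)

(* Defs.v *)
From HB Require Import structures.
From mathcomp Require Import all_boot all_order all_algebra finmap.
From mathcomp Require Import all_classical all_reals all_analysis.

Set Implicit Arguments.
Unset Strict Implicit.
Unset Printing Implicit Defensive.

Import Order.TTheory GRing.Theory Num.Theory.
Import numFieldNormedType.Exports.

Local Open Scope classical_set_scope.
Local Open Scope ring_scope.

(* For a countable discrete group: existence of a Folner sequence, i.e. finite
   nonempty sets A_n with |g A_n symdiff A_n| / |A_n| --> 0 for every g. *)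
Definition amenable (R : realType) (G : groupType) : Prop :=
  exists A : nat -> {fset G},
    (forall n, A n != fset0) /\
    forall g : G,
      let gA n := [fset (g * h)%g | h in A n]%fset in
      (#|` ((gA n `\` A n) `|` (A n `\` gA n))%fset |%:R / #|` A n|%:R : R)
        @[n --> \oo] --> (0 : R).

(* G carries the discrete topology, so joint continuity of G * X -> X amounts
   to continuity of every x |-> g x. *)
Record is_continuous_action (G : groupType) (X : topologicalType)
    (act : G -> X -> X) : Prop := IsContinuousAction {
  caction1 : forall x, act 1%g x = x ;
  cactionM : forall g h x, act (g * h)%g x = act g (act h x) ;
  caction_continuous : forall g, continuous (act g)
}.

(* The quotient takes junk values at n = 0, 1 (where ln n = 0), which the limit
   does not see. *)
Definition growth_condition (R : realType) (G : groupType)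
    (F : nat -> {fset G}) : Prop :=
  (#|` F n|%:R / ln n%:R : R) @[n --> \oo] --> +oo.

Section entropies.
Context {R : realType} {X : metricType R} {G : groupType}.
Variable act : G -> X -> X.

(* Starting the maximum at 0 is harmless since distances are nonnegative. *)
Definition bowen_dist (A : {fset G}) (x y : X) : R :=
  \big[Num.max/0]_(g <- A) mdist (act g x) (act g y).

Definition bowen_cball (A : {fset G}) (x : X) (eps : R) : set X :=
  [set y | bowen_dist A x y <= eps].

Variable F : nat -> {fset G}.

(* A family of balls is given by the set S of its labels (x_i, n_i); the
   pairwise disjoint balls are nonempty, so distinct indices i have distinct
   labels. *)
Definition packing_family (Z : set X) (N : nat) (eps : R)
    (S : set (X * nat)) : Prop :=
  [/\ countable S,
      (forall p, S p -> Z p.1 /\ (N <= p.2)%N) &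
      trivIset S (fun p => bowen_cball (F p.2) p.1 eps)].

Definition packing_preN (Z : set X) (N : nat) (eps s : R) : \bar R :=
  ereal_sup [set (\esum_(p in S) (expR (- s * #|` F p.2|%:R))%:E)%E
            | S in packing_family Z N eps].

Definition packing_pre (Z : set X) (eps s : R) : \bar R :=
  limn (fun N => packing_preN Z N eps s).

Definition packing_outer (Z : set X) (eps s : R) : \bar R :=
  ereal_inf [set (\sum_(0 <= i <oo) packing_pre (Z_ i) eps s)%E
            | Z_ in [set Z_ : nat -> set X | Z `<=` \bigcup_i Z_ i]].

(* The critical value at which packing_outer Z eps jumps from +oo to 0; the
   infimum of the empty set is +oo. *)
Definition hP_eps (Z : set X) (eps : R) : \bar R :=
  ereal_inf [set s%:E | s in [set s : R | 0 <= s /\ packing_outer Z eps s = 0%E]].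

Definition hP (Z : set X) : \bar R := lim (hP_eps Z eps @[eps --> 0^'+]).

Definition bowen_separated (A : {fset G}) (eps : R) (Z E : set X) : Prop :=
  E `<=` Z /\ forall x y, E x -> E y -> x <> y -> eps < bowen_dist A x y.

Definition sep_num (A : {fset G}) (Z : set X) (eps : R) : \bar R :=
  ereal_sup [set counting E | E in bowen_separated A eps Z].

(* sep_num is 0 for Z = set0 and at least 1 otherwise: the maxe only fixes the
   convention log 0 = 0, by which the empty set has entropy 0 (as it does for
   hP_eps) rather than -oo. *)
Definition hUC_eps (Z : set X) (eps : R) : \bar R :=
  limn_esup (fun n =>
    ((#|` F n|%:R^-1)%:E * lne (maxe 1 (sep_num (F n) Z eps)))%E).

Definition hUC (Z : set X) : \bar R := lim (hUC_eps Z eps @[eps --> 0^'+]).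

End entropies.

(* Main.v *)
(** Disjoint closed balls of radius [e] have [e]-separated centers, and
    [3e]-separated points are centers of disjoint closed balls of radius [e].

    For (1), if the capacity entropy of [Z_i] is below [t < s], then for large
    [n] the balls of level [n] in a packing of [Z_i] contribute at most
    [exp (- (s - t) |F_n|)], which the growth condition bounds by [n^-2]; the
    tail of this series tends to 0, so the packing pre-measure of each [Z_i] at
    [s] vanishes.

    For (2), choose [s] below [h^P + delta] with vanishing outer measure and a
    cover of [Z] by sets [Z_i] of total pre-measure below 1: a single level [n]
    of a packing of [Z_i] then has weight at most 1, so a [3e]-separated subset
    of [Z_i] has at most [exp (s |F_n|)] points. *)

Require Import Defs.
From HB Require Import structures.
From mathcomp Require Import all_boot all_order all_algebra finmap.
From mathcomp Require Import all_classical all_reals all_analysis.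
From mathcomp Require Import lra ring.

Set Implicit Arguments.
Unset Strict Implicit.
Unset Printing Implicit Defensive.

Import Order.TTheory GRing.Theory Num.Theory.
Import numFieldNormedType.Exports.

Local Open Scope classical_set_scope.
Local Open Scope ring_scope.

(** * Sums of constants and the tail of the inverse squares *)

(** Turns the total weight of a single packing level, where all weights agree, into weight times
    cardinality, with infinite families included. *)
Lemma esum_cst (R : realType) (T : choiceType) (A : set T) (c : R) : 0 < c ->
  (\esum_(i in A) c%:E = c%:E * counting A)%E.
Proof.
move=> c0; have [finA|infA] := pselect (finite_set A).
  rewrite esum_fset//; last by move=> *; rewrite lee_fin ltW.
  rewrite /counting asboolT// fsbig_finite//= sumEFin -EFinM.
  by rewrite big_const_seq count_predT iter_addr addr0 mulr_natr.
rewrite /counting asboolF// mulry gtr0_sg// mul1e.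
apply: eq_infty => M.
have [n Mn] : exists n : nat, M / c <= n%:R.
  by exists (Num.truncn `|M / c|).+1; rewrite (le_trans (ler_norm _))// ltW//
    truncnS_gt.
have [B BA nB] := infinite_set_fset n infA.
apply: esum_ge; exists [set` B]; first by split.
rewrite fsbig_finite//= set_fsetK sumEFin big_const_seq count_predT iter_addr.
rewrite addr0 lee_fin -mulr_natr mulrC -ler_pdivrMr//.
by rewrite (le_trans Mn)// ler_nat.
Qed.

(** Telescoping: [1/(x+1)^2 <= 1/x - 1/(x+1)], applied from [x = N+1] on. *)
Lemma nneseries_invsqr_tail (R : realType) (N : nat) :
  (\sum_(N.+2 <= k <oo) ((k%:R ^- 2 : R)%:E) <= (N.+1%:R^-1)%:E)%E.
Proof.
have H m : \sum_(N.+2 <= k < N.+2 + m) (k%:R ^- 2 : R) <=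
    N.+1%:R^-1 - (N.+1 + m)%:R^-1.
  elim: m => [|m ih]; first by rewrite !addn0 big_geq// subrr.
  rewrite addnS big_nat_recr/= ?leq_addr//.
  apply: le_trans (lerD ih (lexx _)) _.
  have -> : (N.+2 + m)%:R = (N.+1 + m)%:R + 1 :> R by rewrite natr1.
  have -> : (N.+1 + m.+1)%:R = (N.+1 + m)%:R + 1 :> R by rewrite addnS natr1.
  set x : R := (N.+1 + m)%:R; have x0 : 0 < x by rewrite ltr0n.
  rewrite -addrA lerD2l -subr_ge0.
  have -> : - (x + 1)^-1 - (- x^-1 + (x + 1) ^- 2) = (x * (x + 1) ^+ 2)^-1.
    by field; rewrite !lt0r_neq0//; lra.
  by rewrite invr_ge0 mulr_ge0 ?exprn_ge0//; lra.
apply: lime_le; first by apply: is_cvg_nneseries => n _ _;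
  rewrite lee_fin invr_ge0 exprn_ge0.
near=> M; have NM : (N.+2 <= M)%N by near: M; exact: nbhs_infty_ge.
rewrite -(subnKC NM) sumEFin lee_fin (le_trans (H _))//.
by rewrite gerBl.
Unshelve. all: by end_near. Qed.

(** * Bowen pseudometrics, disjoint balls, and monotonicity of the entropies in the scale *)

Section packing_and_separation.
Context {R : realType} {X : metricType R} {G : groupType}.
Variable act : G -> X -> X.
Implicit Types (A : {fset G}) (x y z : X) (e s t : R) (Z E : set X).

Lemma bowen_dist_ge0 A x y : 0 <= bowen_dist act A x y.
Proof. exact: bigmax_ge_id. Qed.

Lemma bowen_distxx A x : bowen_dist act A x x = 0.
Proof. by apply: bigmax_eq_id => g _; rewrite mdistxx. Qed.

Lemma bowen_dist_sym A x y : bowen_dist act A x y = bowen_dist act A y x.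
Proof. by apply: eq_bigr => g _; rewrite metric_sym. Qed.

Lemma mdist_le_bowen A g x y : g \in A ->
  mdist (act g x) (act g y) <= bowen_dist act A x y.
Proof. by move=> gA; exact: (le_bigmax_seq _ g). Qed.

Lemma bowen_dist_triangle A x y z :
  bowen_dist act A x z <= bowen_dist act A x y + bowen_dist act A y z.
Proof.
rewrite {1}/bowen_dist big_seq; apply: bigmax_le => [|g gA].
  by rewrite addr_ge0// bowen_dist_ge0.
by rewrite (le_trans (metric_triangle _ (act g y) _))// lerD// mdist_le_bowen.
Qed.

(** Two balls sharing a point [z] have centers at distance at most [2e], and [2e <= 3e]. *)
Lemma bowen_separated_trivIset A e Z E : 0 <= e ->
  bowen_separated act A (3 * e) Z E ->
  trivIset E (fun x => bowen_cball act A x e).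
Proof.
move=> e0 [_ sepE] x y Ex Ey [z [/= xz yz]]; apply: contrapT => xy.
have := sepE _ _ Ex Ey xy; apply/negP; rewrite -leNgt.
rewrite (le_trans (bowen_dist_triangle _ _ z _))// [X in _ + X]bowen_dist_sym.
by move: xz yz; rewrite /bowen_cball/=; lra.
Qed.

(** If [y] were within [e] of [x], then [y] itself would lie in both balls. *)
Lemma trivIset_bowen_separated A e Z E : 0 <= e -> E `<=` Z ->
  trivIset E (fun x => bowen_cball act A x e) -> bowen_separated act A e Z E.
Proof.
move=> e0 EZ tE; split=> // x y Ex Ey xy; rewrite ltNge; apply/negP => xye.
by apply: xy; apply: tE => //; exists y; split;
  rewrite //= /bowen_cball/= bowen_distxx.
Qed.

Lemma sep_num_ge0 A Z e : (0 <= sep_num act A Z e)%E.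
Proof.
apply: ereal_sup_ubound; exists set0; first by split.
by rewrite /counting asboolT// fset_set0.
Qed.

Variable F : nat -> {fset G}.

Lemma packing_preN_ge0 Z N e s : (0 <= packing_preN act F Z N e s)%E.
Proof.
apply: ereal_sup_ubound; exists set0; last by rewrite esum_set0.
by split => //; exact: trivIset_set0.
Qed.

(** Labels and weights do not involve the radius, and shrinking the balls keeps them disjoint, so
    the same family is admissible on the right. *)
Lemma le_packing_preN Z1 Z2 N1 N2 e1 e2 s : Z1 `<=` Z2 -> (N2 <= N1)%N ->
  e2 <= e1 ->
  (packing_preN act F Z1 N1 e1 s <= packing_preN act F Z2 N2 e2 s)%E.
Proof.
move=> Z12 N21 e21; apply/ereal_sup_le/image_subset => S [cS SZ tS].
split => //; first by move=> p /SZ[/Z12 ? /(leq_trans N21)].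
move=> p q Sp Sq [z [pz qz]]; apply: tS => //; exists z.
by split; rewrite /bowen_cball/= (le_trans _ e21).
Qed.

Lemma packing_preE Z e s :
  packing_pre act F Z e s =
    ereal_inf (range (fun N => packing_preN act F Z N e s)).
Proof.
by apply/cvg_lim => //; apply: ereal_nonincreasing_cvgn => m n mn;
  exact: le_packing_preN.
Qed.

Lemma packing_pre_ge0 Z e s : (0 <= packing_pre act F Z e s)%E.
Proof.
by rewrite packing_preE; apply: le_ereal_inf_tmp => _ [N _ <-];
  exact: packing_preN_ge0.
Qed.

Lemma le_packing_pre Z1 Z2 e1 e2 s : Z1 `<=` Z2 -> e2 <= e1 ->
  (packing_pre act F Z1 e1 s <= packing_pre act F Z2 e2 s)%E.
Proof.
move=> Z12 e21; rewrite !packing_preE; apply: le_ereal_inf_tmp => _ [N _ <-].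
by apply: ge_ereal_inf; exists (packing_preN act F Z1 N e1 s);
  [exists N|exact: le_packing_preN].
Qed.

Lemma packing_outer_ge0 Z e s : (0 <= packing_outer act F Z e s)%E.
Proof.
apply: le_ereal_inf_tmp => _ [Z_ _ <-]; apply: nneseries_ge0 => n _ _.
exact: packing_pre_ge0.
Qed.

Lemma le_packing_outer Z e1 e2 s : e2 <= e1 ->
  (packing_outer act F Z e1 s <= packing_outer act F Z e2 s)%E.
Proof.
move=> e21; apply: le_ereal_inf_tmp => _ [Z_ ZZ <-]; apply: ge_ereal_inf.
exists (\sum_(0 <= i <oo) packing_pre act F (Z_ i) e1 s)%E; first by exists Z_.
apply: lee_nneseries => i *; first exact: packing_pre_ge0.
exact: le_packing_pre.
Qed.

Lemma hP_eps_ge0 Z e : (0 <= hP_eps act F Z e)%E.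
Proof. by apply: le_ereal_inf_tmp => _ [s [s0 _] <-]. Qed.

(** A larger radius lowers the outer measure, so more values of [s] make it vanish. *)
Lemma le_hP_eps Z e1 e2 : e2 <= e1 ->
  (hP_eps act F Z e1 <= hP_eps act F Z e2)%E.
Proof.
move=> e21; apply: ereal_inf_le_tmp; apply: image_subset => s [s0 H].
split; first exact: s0.
apply: le_anti; apply/andP; split; last exact: packing_outer_ge0.
by rewrite -[leRHS]H; exact: le_packing_outer.
Qed.

Lemma le_sep_num A Z e1 e2 : e2 <= e1 ->
  (sep_num act A Z e1 <= sep_num act A Z e2)%E.
Proof.
move=> e21; apply/ereal_sup_le/image_subset => E [EZ sE]; split=> //
  x y Ex Ey xy.
by rewrite (le_lt_trans e21)// sE.
Qed.

Lemma hUC_eps_ge0 Z e : (0 <= hUC_eps act F Z e)%E.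
Proof.
apply: limf_esup_ge0 => [|n]; first exact: filter_not_empty.
by rewrite mule_ge0 ?lee_fin ?invr_ge0// lne_ge0 le_max lexx.
Qed.

Lemma le_hUC_eps Z e1 e2 : e2 <= e1 ->
  (hUC_eps act F Z e1 <= hUC_eps act F Z e2)%E.
Proof.
move=> e21; apply: le_ereal_inf_tmp => _ [V ooV <-]; apply: ge_ereal_inf.
eexists; first by exists V; [exact: ooV|reflexivity].
apply: ge_ereal_sup => _ [n Vn <-]; apply: ereal_sup_ge.
eexists; first by exists n; [exact: Vn|reflexivity].
rewrite lee_wpmul2l ?lee_fin ?invr_ge0// lee_lne ?in_itv/=.
- by rewrite le_max2 ?lexx// le_sep_num.
- by rewrite leey andbT le_max lee01.
- by rewrite leey andbT le_max lee01.
Qed.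

(** Monotonicity in the scale makes the limit at [0^'+] a supremum, so bounds can be proved one
    scale at a time. *)
Lemma hP_sup Z : hP act F Z =
  ereal_sup [set hP_eps act F Z e | e in `]0, +oo[%classic].
Proof.
apply/cvg_lim; first exact: ereal_hausdorff.
apply: (@nonincreasing_at_right_cvge R (hP_eps act F Z) 0 +oo%O).
  by [].
by move=> e1 e2 _ _; exact: le_hP_eps.
Qed.

Lemma hUC_sup Z : hUC act F Z =
  ereal_sup [set hUC_eps act F Z e | e in `]0, +oo[%classic].
Proof.
apply/cvg_lim; first exact: ereal_hausdorff.
apply: (@nonincreasing_at_right_cvge R (hUC_eps act F Z) 0 +oo%O).
  by [].
by move=> e1 e2 _ _; exact: le_hUC_eps.
Qed.

End packing_and_separation.

(** * Comparing packing weights with separation numbers, level by level *)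

Section packing_versus_capacity.
Context {R : realType} {X : metricType R} {G : groupType}.
Variables (act : G -> X -> X) (F : nat -> {fset G}).
Implicit Types (e s t : R) (Z E : set X).

(** Group a packing by level: at level [n] all weights are equal, and the centers, having disjoint
    balls, form a separated set. *)
Lemma packing_preN_le_sep_num Z N e s : 0 <= e ->
  (packing_preN act F Z N e s <=
   \sum_(N <= n <oo) (expR (- s * #|` F n|%:R))%:E * sep_num act (F n) Z e)%E.
Proof.
move=> e0; apply: ge_ereal_sup => _ [S [_ SZ tS] <-].
pose S_ n := S `&` [set p | p.2 = n].
have -> : S = \bigcup_n S_ n.
  by apply/seteqP; split=> [p Sp|p [n _ []//]]; exists p.2.
rewrite nneseries_sum_bigcup => [|m n _ _ [p [[_ <-] [_ <-]]]//|p]; last first.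
  by rewrite lee_fin expR_ge0.
have S_0 n : (n < N)%N -> S_ n = set0.
  move=> nN; apply/seteqP; split=> // p [/SZ[_ +] /= pn].
  by rewrite pn leqNgt nN.
rewrite (nneseries_split 0 N) => [|k _]; last first.
  by apply: esum_ge0 => p _; rewrite lee_fin expR_ge0.
rewrite add0n big_nat_cond big1 ?add0e => [|n /andP[/andP[_ nN] _]]; last first.
  by rewrite S_0// esum_set0.
apply: lee_nneseries => n.
  by move=> _ _; apply: esum_ge0 => p _; rewrite lee_fin expR_ge0.
move=> _.
rewrite (eq_esum (b := fun=> (expR (- s * #|` F n|%:R))%:E)); last first.
  by move=> p [_ ->].
(* Within one level the center determines the label, so the sum can be indexed by centers. *)
have injS : set_inj (S_ n) (@fst X nat).
  move=> [x i] [y j] /set_mem[_ /= ->] /set_mem[_ /= ->] /= ->//.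
rewrite -(@esum_image _ _ _ _ _ (fun=> (expR (- s * #|` F n|%:R))%:E) injS).
rewrite esum_cst ?expR_gt0// lee_wpmul2l ?lee_fin ?expR_ge0//.
apply: ereal_sup_ubound; exists (fst @` S_ n) => //.
apply: trivIset_bowen_separated => // [_ [p [/SZ[Zp _] _] <-]//|].
move=> _ _ [[x i] [Sx /= iN] <-] [[y j] [Sy /= jN] <-] xy; subst i j.
by have [] := tS _ _ Sx Sy xy.
Qed.

Lemma sep_num_le_packing_preN Z N n e s : 0 <= e -> (N <= n)%N ->
  ((expR (- s * #|` F n|%:R))%:E * sep_num act (F n) Z (3 * e) <=
   packing_preN act F Z N e s)%E.
Proof.
move=> e0 Nn; set c := expR _; have c0 : 0 < c by exact: expR_gt0.
rewrite muleC -lee_pdivlMr//; apply: ge_ereal_sup => _ [E sepE <-].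
(* The cardinality becomes a sum again, hence a supremum over finite [B] in [E]; each [B] gives a
   countable packing at level [n]. *)
rewrite lee_pdivlMr// muleC -esum_cst//;
  apply: ge_ereal_sup => _ [B [finB BE] <-].
rewrite -esum_fset => [||x _]; [|exact: finB|by rewrite lee_fin ltW].
pose f x : X * nat := (x, n).
have fI : set_inj B f by move=> x y _ _ [].
apply: ereal_sup_ubound; exists (f @` B).
  split; first exact/finite_set_countable/finite_image.
    by move=> _ [x /BE Ex <-] /=; split=> //; exact: sepE.1.
  move=> _ _ [x /BE Ex <-] [y /BE Ey <-] /= xy; congr pair.
  exact: (bowen_separated_trivIset e0 sepE).
by rewrite (@esum_image _ _ _ _ _
  (fun p => (expR (- s * #|` F p.2|%:R))%:E) fI).
Qed.

(** A limsup below [t] keeps the terms below [t] eventually; nonemptiness of [F n] allows clearing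
    the denominator. *)
Lemma hUC_eps_lt_sep_num Z e t : 0 <= t -> (hUC_eps act F Z e < t%:E)%E ->
  (\forall n \near \oo, (0 < #|` F n|)%N) ->
  \forall n \near \oo, (sep_num act (F n) Z e <= (expR (t * #|` F n|%:R))%:E)%E.
Proof.
move=> t0 /ereal_inf_lt[_ [V ooV <-] supV] F0; near=> n.
have Fn0 : 0 < #|` F n|%:R :> R by rewrite ltr0n; near: n.
have Vn : V n by near: n.
have /ltW := le_lt_trans (ereal_sup_ubound (imageP _ Vn)) supV.
rewrite muleC lee_pdivrMr// -EFinM => H.
apply: (@le_trans _ _ (maxe 1 (sep_num act (F n) Z e))%E).
  by rewrite le_max lexx orbT.
rewrite -[X in (X <= _)%E]lneK; last first.
  by rewrite in_itv/= leey andbT le_max lee01.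
by rewrite -[leRHS]/(expeR (t * #|` F n|%:R)%:E) lee_expeR.
Unshelve. all: by end_near. Qed.

Lemma sep_num_hUC_eps_le Z e s : 0 <= s ->
  (\forall n \near \oo, (sep_num act (F n) Z e <=
    (expR (s * #|` F n|%:R))%:E)%E) ->
  (hUC_eps act F Z e <= s%:E)%E.
Proof.
move=> s0 ooV; apply: ge_ereal_inf; eexists.
  by eexists; [exact: ooV|reflexivity].
apply: ge_ereal_sup => _ [n Vn <-].
apply: (@le_trans _ _ ((#|` F n|%:R^-1)%:E * (s * #|` F n|%:R)%:E)%E).
  rewrite lee_wpmul2l ?lee_fin ?invr_ge0// -lee_expeR lneK; last first.
    by rewrite in_itv/= leey andbT le_max lee01.
  (* Since [s >= 0], the exponential is at least 1 and so also dominates the 1 inside [maxe]. *)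
  by rewrite ge_max Vn andbT lee_fin -expR0 ler_expR mulr_ge0.
rewrite -EFinM lee_fin mulrCA ler_piMr//.
(* For empty [F n] the inverse of 0 is 0, so the ratio is 0 instead of 1; either way it is at most
   1. *)
by have [->|?] := eqVneq (#|` F n|%:R : R) 0; rewrite ?mulr0// mulVf.
Qed.

Lemma growth_condition_near (c : R) : growth_condition R F ->
  \forall n \near \oo, c * ln n%:R <= #|` F n|%:R.
Proof.
move=> /cvgryPge/(_ c) H; near=> n.
have n1 : 0 < ln n%:R :> R by rewrite ln_gt0// ltr1n; near: n;
  exact: nbhs_infty_gt.
by rewrite -ler_pdivlMr//; near: n.
Unshelve. all: by end_near. Qed.

Lemma growth_condition_card_gt0 : growth_condition R F ->
  \forall n \near \oo, (0 < #|` F n|)%N.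
Proof.
move=> gF; have H := growth_condition_near 1 gF; near=> n.
rewrite -(ltr0n R) (@lt_le_trans _ _ (1 * ln n%:R))//; last by near: n.
by rewrite mul1r ln_gt0// ltr1n; near: n; exact: nbhs_infty_gt.
Unshelve. all: by end_near. Qed.

Lemma packing_pre_eq0 Z e s t : growth_condition R F -> 0 <= e -> 0 <= t < s ->
  (hUC_eps act F Z e < t%:E)%E -> packing_pre act F Z e s = 0%E.
Proof.
move=> gF e0 /andP[t0 ts] hZ.
have Hsep := hUC_eps_lt_sep_num t0 hZ (growth_condition_card_gt0 gF).
(* With this constant [(s - t) |F n| >= 2 ln n], which gives exactly the bound [n^-2]. *)
have HF := growth_condition_near (2 / (s - t)) gF.
have [N0 _ HN] : \forall n \near \oo, ((expR (- s * #|` F n|%:R))%:E *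
    sep_num act (F n) Z e <= (n%:R ^- 2)%:E)%E.
  near=> n; have n0 : 0 < n%:R :> R by rewrite ltr0n; near: n;
    exact: nbhs_infty_gt.
  apply: (@le_trans _ _
    ((expR (- s * #|` F n|%:R))%:E * (expR (t * #|` F n|%:R))%:E)%E).
    by rewrite lee_wpmul2l ?lee_fin ?expR_ge0//; near: n.
  rewrite -EFinM lee_fin -expRD.
  rewrite -[leRHS]lnK ?posrE ?invr_gt0 ?exprn_gt0//
    ler_expR lnV ?posrE ?exprn_gt0//.
  rewrite lnXn// -mulr_natl.
  have : 2 / (s - t) * ln n%:R <= #|` F n|%:R by near: n.
  by rewrite mulrAC ler_pdivrMr ?subr_gt0//; lra.
apply: le_anti; apply/andP; split; last exact: packing_pre_ge0.
apply/lee_addgt0Pr => d d0; rewrite add0e packing_preE.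
have [n nd] : exists n : nat, n.+1%:R^-1 <= d.
  exists (Num.truncn d^-1); rewrite -[leRHS]invrK lef_pV2 ?posrE ?invr_gt0//.
  by rewrite ltW// truncnS_gt.
(* From [N.+2] on the termwise bound holds, and the tail is at most [1/(N+1) <= 1/(n+1) <= d]. *)
pose N := maxn N0 n.
apply: ge_ereal_inf; exists (packing_preN act F Z N.+2 e s);
  first by exists N.+2.
apply: (le_trans (packing_preN_le_sep_num _ _ _ e0)).
apply: (@le_trans _ _ (\sum_(N.+2 <= k <oo) (k%:R ^- 2)%:E)%E).
  (* Moves the lower limit into the summation predicate, so that the termwise comparison may use
     [N.+2 <= k]. *)
  rewrite [leLHS]eseries_cond [leRHS]eseries_cond.
  apply: lee_nneseries => k.
    by move=> _ _; rewrite mule_ge0 ?lee_fin ?expR_ge0 ?sep_num_ge0.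
  by move=> Nk; apply: HN; rewrite /= (leq_trans _ Nk)//
    -addn2 (leq_trans (leq_maxl N0 n))// leq_addr.
apply: (le_trans (nneseries_invsqr_tail _ _));
  rewrite lee_fin (le_trans _ nd)//.
by rewrite lef_pV2 ?posrE// ler_nat ltnS leq_maxr.
Unshelve. all: by end_near. Qed.


(** * Passing to countable covers *)

Lemma hP_eps_le_sup_hUC_eps (Z_ : nat -> set X) e :
  growth_condition R F -> 0 <= e ->
  (hP_eps act F (\bigcup_i Z_ i) e <=
   ereal_sup (range (fun i => hUC_eps act F (Z_ i) e)))%E.
Proof.
move=> gF e0; set M := ereal_sup _.
have leM i : (hUC_eps act F (Z_ i) e <= M)%E by apply: ereal_sup_ubound;
  exists i.
have M0 : (0 <= M)%E := le_trans (hUC_eps_ge0 _ _ _ _) (leM 0%N).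
case: M M0 leM => [r||]; [|by move=> _ _; rewrite leey|by []].
rewrite lee_fin => r0 leM; apply/lee_addgt0Pr => d d0; rewrite -EFinD.
apply: ereal_inf_lbound; exists (r + d) => //; split; first by lra.
apply: le_anti; apply/andP; split; last exact: packing_outer_ge0.
apply: ge_ereal_inf.
exists (\sum_(0 <= i <oo) packing_pre act F (Z_ i) e (r + d))%E.
  by exists Z_.
(* The intermediate exponent [r + d / 2] lies strictly between the capacity entropies, all at most
   [r], and [s = r + d]. *)
rewrite eseries0// => i _ _; apply: (@packing_pre_eq0 _ _ _ (r + d / 2)) => //.
  by apply/andP; split; lra.
by rewrite (le_lt_trans (leM i))// lte_fin; lra.
Qed.

Lemma hP_le_sup_hUC (Z_ : nat -> set X) : growth_condition R F ->
  (hP act F (\bigcup_i Z_ i) <=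
    ereal_sup (range (fun i => hUC act F (Z_ i))))%E.
Proof.
move=> gF; rewrite hP_sup; apply: ge_ereal_sup => _ [e e0 <-].
have e0' : 0 <= e by move: e0; rewrite /= in_itv/= andbT => /ltW.
apply: (le_trans (hP_eps_le_sup_hUC_eps _ gF e0')).
apply: ge_ereal_sup => _ [i _ <-]; apply: ereal_sup_ge.
exists (hUC act F (Z_ i)); first by exists i.
by rewrite hUC_sup; apply: ereal_sup_ubound; exists e.
Qed.

(** Some [packing_preN] is already below 1, and it bounds the weight of every single level
    [n >= N]. *)
Lemma hUC_eps_le_of_packing_pre_lt1 Z e s : 0 <= e -> 0 <= s ->
  (packing_pre act F Z e s < 1)%E -> (hUC_eps act F Z (3 * e) <= s%:E)%E.
Proof.
move=> e0 s0; rewrite packing_preE => /ereal_inf_lt[_ [N _ <-] PN].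
apply: sep_num_hUC_eps_le => //; exists N => // n /= Nn.
have := le_trans (sep_num_le_packing_preN Z s e0 Nn) (ltW PN).
by rewrite muleC -lee_pdivlMr ?expR_gt0// mul1e mulNr expRN invrK.
Qed.

Lemma packing_outer_eq0_cover Z e s : 0 <= e -> 0 <= s ->
  packing_outer act F Z e s = 0%E ->
  exists Z_ : nat -> set X, \bigcup_i Z_ i = Z /\
    (forall i, (hUC_eps act F (Z_ i) (3 * e) <= s%:E)%E).
Proof.
move=> e0 s0 P0.
have /ereal_inf_lt[_ [Z_ ZZ <-] sum1] : (packing_outer act F Z e s < 1)%E.
  by rewrite P0 lte01.
(* The cover from the outer measure may exceed [Z]; intersecting gives equality and only lowers the
   pre-measures. *)
exists (fun i => Z_ i `&` Z); split; first by rewrite -setI_bigcupl setIidr.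
move=> i; apply: hUC_eps_le_of_packing_pre_lt1 => //.
apply: le_lt_trans sum1;
  apply: le_trans (le_packing_pre _ _ _ (@subIsetl _ _ _) (lexx e)) _.
(* Each pre-measure is one term of a nonnegative series with sum below 1. *)
rewrite (@nneseriesD1 _ _ i)//; last by move=> k _; exact: packing_pre_ge0.
by rewrite leeDl// nneseries_ge0// => k _ _; exact: packing_pre_ge0.
Qed.

End packing_versus_capacity.

(** * Assembling the three inequalities *)

Theorem proposition2p7 (R : realType) (X : metricType R) (G : groupType)
    (act : G -> X -> X)
    (compactX : compact [set: X])
    (countableG : countable [set: G])
    (infiniteG : infinite_set [set: G])
    (amenableG : amenable R G)
    (contact : is_continuous_action act)
    (eps : R) (eps_gt0 : 0 < eps) (Z : set X)
    (F : nat -> {fset G}) (growthF : growth_condition R F) :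
  [/\ (hP_eps act F Z eps <=
        ereal_inf [set ereal_sup (range (fun i => hUC_eps act F (Z_ i) eps))
                  | Z_ in [set Z_ : nat -> set X | Z = \bigcup_i Z_ i]])%E,
      (hP act F Z <=
        ereal_inf [set ereal_sup (range (fun i => hUC act F (Z_ i)))
                  | Z_ in [set Z_ : nat -> set X | Z = \bigcup_i Z_ i]])%E &
      forall delta : R, 0 < delta ->
        exists Z_ : nat -> set X, \bigcup_i Z_ i = Z /\
          (ereal_sup (range (fun i => hUC_eps act F (Z_ i) (3 * eps)%R)) <=
            hP_eps act F Z eps + delta%:E)%E].
Proof.
split.
- by apply: le_ereal_inf_tmp => _ [Z_ -> <-];
    exact: hP_eps_le_sup_hUC_eps (ltW _).
- by apply: le_ereal_inf_tmp => _ [Z_ -> <-]; exact: hP_le_sup_hUC.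
- move=> delta delta0.
  (* With infinite packing entropy the bound is trivial and the constant cover by [Z] will do. *)
  have [hoo|] := eqVneq (hP_eps act F Z eps) +oo%E.
    by exists (fun=> Z); split; [rewrite bigcup_const|rewrite hoo addye// leey].
  (* Finiteness makes adding [delta] a strict increase, so the infimum yields an admissible [s]
     below the sum. *)
  move=> hfin; have hlt :
    (hP_eps act F Z eps < hP_eps act F Z eps + delta%:E)%E.
    rewrite lteDl ?lte_fin// ge0_fin_numE ?hP_eps_ge0//.
    by rewrite lt_neqAle hfin leey.
  have [_ [s [s0 P0] <-] sh] := ereal_inf_lt hlt.
  have [Z_ [ZE Zs]] := packing_outer_eq0_cover (ltW eps_gt0) s0 P0.
  exists Z_; split=> //; apply: ge_ereal_sup => _ [i _ <-].
  exact: le_trans (Zs i) (ltW sh).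
Qed.
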